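(* Consider an $(h,q)$-eventually periodic uncertain plant $(G,\bm{\Delta})$ given by $$\begin{bmatrix} z_{k+1} \\ \varphi_k \\ e_k \\ \hat{y}_k \end{bmatrix} = \begin{bmatrix} A_{ss}(k) & A_{sp}(k) & B_{1s}(k) & B_{2s}(k)\\ A_{ps}(k) & A_{pp}(k) & B_{1p}(k) & B_{2p}(k)\\ C_{1s}(k) & C_{1p}(k) & D_{11}(k) & D_{12}(k) \\ C_{2s}(k) & C_{2p}(k) & D_{21}(k) & 0 \end{bmatrix} \begin{bmatrix} z_k \\ \vartheta_k \\ d_k \\ u_k \end{bmatrix}, \quad \vartheta_k = \Delta(k)\varphi_k,\ \Delta\in\bm{\Delta},$$ with $z_k\in\mathbb{R}^N$ and $\Delta(k)=\mathrm{diag}(\delta_k^{[1]}I_{m_1},\dots,\delta_k^{[p]}I_{m_p})$, $|\delta_k^{[i]}|\le1$. Suppose the initial state is uncertain and can be expressed as $z_0 = \Gamma \xi$, where $\Gamma \in \mathbb{R}^{N \times s}$, $\xi = (\xi_1, \dots, \xi_a)$, $\xi_i \in \mathbb{R}^{s_i}$, $\sum_{i=1}^{a} s_i = s \leq N$. Given $\bar{h} \geq h$, an $(\bar{h},q)$-eventually periodic (dynamic output feedback NSLPV) controller exists for this plant such that the uncertain closed loop satisfies $$\sup\{\lVert e \rVert_{\ell_2} \mid \lVert \xi_1 \rVert_{2} \leq 1, \dots, \lVert \xi_a \rVert_{2} \leq 1, \lVert d \rVert_{\ell_2} \leq 1, \Delta \in \bm{\Delta} \}< \gamma$$ if there exist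 positive definite matrices $R_0(k), S_0(k) \in \mathbb{S}^{N}$, $R_i(k), S_i(k) \in \mathbb{S}^{m_i}$ for $i \in \{1,\dots,p\}$ and $k = 0,1,\dots,\bar{h}+q-1$, and positive scalars $b, f_{11}, \dots, f_{1a}, f_{2}, g, t$ such that $$b + \sum_{i=1}^{a} f_{1i} + f_2 < 2\gamma, \quad \Gamma^T S_0(0) \Gamma \prec F_1,$$ $$N_R(k)^T \left\{ H(k) \begin{bmatrix} R_0(k) & 0 & 0 \\ 0 & \bar{R}(k) & 0 \\ 0 & 0 & g I \end{bmatrix} H(k)^T - \begin{bmatrix} R_0(k+1) & 0 & 0 \\ 0 & \bar{R}(k) & 0 \\ 0 & 0 & b I \end{bmatrix} \right\} N_R(k) \prec 0,$$ $$N_S(k)^T \left\{ H(k)^T \begin{bmatrix} S_0(k+1) & 0 & 0 \\ 0 & \bar{S}(k) & 0 \\ 0 & 0 & t I \end{bmatrix} H(k) - \begin{bmatrix} S_0(k) & 0 & 0 \\ 0 & \bar{S}(k) & 0 \\ 0 & 0 & f_2 I \end{bmatrix} \right\} N_S(k) \prec 0,$$ $$\begin{bmatrix} R_i(k) & I \\ I & S_i(k)\end{bmatrix} \succeq 0, \quad \begin{bmatrix} g & 1 \\ 1 & f_2 \end{bmatrix} \succeq 0, \quad \begin{bmatrix} t & 1 \\ 1 & b \end{bmatrix} \succeq 0,$$ for $i = 0,1,\dots,p$ and $k = 0,1,\dots,\bar{h}+q-1$, where $R_0(\bar{h}+q) = R_0(\bar{h})$, $S_0(\bar{h}+q) = S_0(\bar{h})$,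 $\bar{R}(k) = \mathrm{diag}(R_1(k), \dots, R_p(k))$, $\bar{S}(k) = \mathrm{diag}(S_1(k), \dots, S_p(k))$, $\mathrm{Im}\, N_R(k) = \mathrm{Ker} \begin{bmatrix} B_{2s}(k)^T & B_{2p}(k)^T & D_{12}(k)^T \end{bmatrix}$, $\mathrm{Im}\, N_S(k) = \mathrm{Ker} \begin{bmatrix} C_{2s}(k) & C_{2p}(k) & D_{21}(k) \end{bmatrix}$, $N_R(k)^TN_R(k) = I$, $N_S(k)^TN_S(k) = I$, $$H(k) = \begin{bmatrix} A_{ss}(k) & A_{sp}(k) & B_{1s}(k) \\ A_{ps}(k) & A_{pp}(k) & B_{1p}(k) \\ C_{1s}(k) & C_{1p}(k) & D_{11}(k) \end{bmatrix}, \quad F_1 = \mathrm{diag}(f_{11}I_{s_1}, \dots, f_{1a}I_{s_a}).$$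
   Context: A matrix sequence $P$ is $(h,q)$-eventually periodic if $P(h+k+iq)=P(h+k)$ for all nonnegative integers $i,k$; a system is $(h,q)$-eventually periodic if all its state-space matrix sequences are. The controller has the form $z^c_{k+1}=A^c_{ss}(k)z^c_k+A^c_{sp}(k)\vartheta^c_k+B^c_s(k)\hat y_k$, $\varphi^c_k=A^c_{ps}(k)z^c_k+A^c_{pp}(k)\vartheta^c_k+B^c_p(k)\hat y_k$, $u_k=C^c_s(k)z^c_k+C^c_p(k)\vartheta^c_k+D^c(k)\hat y_k$, $\vartheta^c_k=\mathrm{diag}(\delta_k^{[1]}I_{m^c_1(k)},\dots,\delta_k^{[p]}I_{m^c_p(k)})\varphi^c_k$, $z^c_0=0$. $\mathbb{S}^m$ denotes real symmetric $m\times m$ matrices. *)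

(* Defs.v *)
From HB Require Import structures.
From mathcomp Require Import all_boot all_order all_algebra.
From mathcomp Require Import all_classical all_reals all_analysis.
Set Implicit Arguments. Unset Strict Implicit. Unset Printing Implicit Defensive.
Import Order.TTheory GRing.Theory Num.Theory.
Local Open Scope ring_scope.
Local Open Scope classical_set_scope.

Section Defs.
Variable R : realType.

Definition posdef n (A : 'M[R]_n) : Prop :=
  A^T = A /\ forall x : 'cV[R]_n, x != 0 -> 0 < (x^T *m A *m x) 0 0.
Definition possemidef n (A : 'M[R]_n) : Prop :=
  A^T = A /\ forall x : 'cV[R]_n, 0 <= (x^T *m A *m x) 0 0.
Definition negdef n (A : 'M[R]_n) : Prop := posdef (- A).

Definition im_eq_ker n r l (Nm : 'M[R]_(n, r)) (Q : 'M[R]_(l, n)) : Prop :=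
  forall x : 'cV[R]_n, (exists y : 'cV[R]_r, x = Nm *m y) <-> Q *m x = 0.

Definition diag3 n1 n2 n3 (A : 'M[R]_n1) (B : 'M[R]_n2) (C : 'M[R]_n3)
  : 'M[R]_(n1 + n2 + n3) := block_mx (block_mx A 0 0 B) 0 0 C.

Definition mx3 r1 r2 r3 c1 c2 c3
  (a11 : 'M[R]_(r1, c1)) (a12 : 'M[R]_(r1, c2)) (a13 : 'M[R]_(r1, c3))
  (a21 : 'M[R]_(r2, c1)) (a22 : 'M[R]_(r2, c2)) (a23 : 'M[R]_(r2, c3))
  (a31 : 'M[R]_(r3, c1)) (a32 : 'M[R]_(r3, c2)) (a33 : 'M[R]_(r3, c3))
  : 'M[R]_(r1 + r2 + r3, c1 + c2 + c3) :=
  block_mx (block_mx a11 a12 a21 a22) (col_mx a13 a23) (row_mx a31 a32) a33.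

Definition row3 l c1 c2 c3 (a : 'M[R]_(l, c1)) (b : 'M[R]_(l, c2))
  (c : 'M[R]_(l, c3)) : 'M[R]_(l, c1 + c2 + c3) := row_mx (row_mx a b) c.

Definition vnorm n (x : 'cV[R]_n) : R := Num.sqrt (\sum_(j < n) (x j 0) ^+ 2).

Definition l2sq n (x : nat -> 'cV[R]_n) : \bar R :=
  (\sum_(0 <= k <oo) ((\sum_(j < n) (x k j 0) ^+ 2)%:E))%E.

Definition l2norm n (x : nat -> 'cV[R]_n) : \bar R :=
  match l2sq x with
  | EFin r => (Num.sqrt r)%:E
  | +oo%E => +oo%E
  | -oo%E => -oo%E
  end.

Definition ev_periodic r c (P : nat -> 'M[R]_(r, c)) (h q : nat) : Prop :=
  forall i k, P (h + k + i * q)%N = P (h + k)%N.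

(* (h,q)-eventually periodic matrix sequence with time-varying dimensions:
   the dimensions and the entries are repeated *)
Definition ev_periodic_dep (r c : nat -> nat) (P : forall k : nat, 'M[R]_(r k, c k))
  (h q : nat) : Prop :=
  forall i k,
    existT (fun rc : nat * nat => 'M[R]_(rc.1, rc.2))
      (r (h + k + i * q)%N, c (h + k + i * q)%N) (P (h + k + i * q)%N)
    = existT (fun rc : nat * nat => 'M[R]_(rc.1, rc.2))
      (r (h + k)%N, c (h + k)%N) (P (h + k)%N).

(* nx = N (state), m i = block sizes of Delta, nd, ne, nu, ny = dims of d, e, u, y *)
Record plant (nx p : nat) (m : 'I_p -> nat) (nd ne nu ny : nat) := Plant {
  Ass : nat -> 'M[R]_(nx, nx);
  Asp : nat -> 'M[R]_(nx, \sum_(i < p) m i);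
  B1s : nat -> 'M[R]_(nx, nd);
  B2s : nat -> 'M[R]_(nx, nu);
  Aps : nat -> 'M[R]_(\sum_(i < p) m i, nx);
  App : nat -> 'M[R]_(\sum_(i < p) m i, \sum_(i < p) m i);
  B1p : nat -> 'M[R]_(\sum_(i < p) m i, nd);
  B2p : nat -> 'M[R]_(\sum_(i < p) m i, nu);
  C1s : nat -> 'M[R]_(ne, nx);
  C1p : nat -> 'M[R]_(ne, \sum_(i < p) m i);
  D11 : nat -> 'M[R]_(ne, nd);
  D12 : nat -> 'M[R]_(ne, nu);
  C2s : nat -> 'M[R]_(ny, nx);
  C2p : nat -> 'M[R]_(ny, \sum_(i < p) m i);
  D21 : nat -> 'M[R]_(ny, nd)
}.

Definition plant_ev_periodic nx p m nd ne nu ny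
  (G : @plant nx p m nd ne nu ny) (h q : nat) : Prop :=
  ev_periodic (Ass G) h q /\
  ev_periodic (Asp G) h q /\
  ev_periodic (B1s G) h q /\
  ev_periodic (B2s G) h q /\
  ev_periodic (Aps G) h q /\
  ev_periodic (App G) h q /\
  ev_periodic (B1p G) h q /\
  ev_periodic (B2p G) h q /\
  ev_periodic (C1s G) h q /\
  ev_periodic (C1p G) h q /\
  ev_periodic (D11 G) h q /\
  ev_periodic (D12 G) h q /\
  ev_periodic (C2s G) h q /\
  ev_periodic (C2p G) h q /\
  ev_periodic (D21 G) h q.

(* state dimension nc k and scheduling block sizes mc k i may vary with k *)
Record controller (p nu ny : nat) := Controller {
  nc : nat -> nat;
  mc : nat -> 'I_p -> nat;
  Acss : forall k : nat, 'M[R]_(nc k.+1, nc k);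
  Acsp : forall k : nat, 'M[R]_(nc k.+1, \sum_(i < p) mc k i);
  Bcs  : forall k : nat, 'M[R]_(nc k.+1, ny);
  Acps : forall k : nat, 'M[R]_(\sum_(i < p) mc k i, nc k);
  Acpp : forall k : nat, 'M[R]_(\sum_(i < p) mc k i, \sum_(i < p) mc k i);
  Bcp  : forall k : nat, 'M[R]_(\sum_(i < p) mc k i, ny);
  Ccs  : forall k : nat, 'M[R]_(nu, nc k);
  Ccp  : forall k : nat, 'M[R]_(nu, \sum_(i < p) mc k i);
  Dc   : forall k : nat, 'M[R]_(nu, ny)
}.

Definition ctrl_ev_periodic p nu ny (K : @controller p nu ny) (h q : nat) : Prop :=
  ev_periodic_dep (Acss K) h q /\
  ev_periodic_dep (Acsp K) h q /\
  ev_periodic_dep (Bcs K) h q /\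
  ev_periodic_dep (Acps K) h q /\
  ev_periodic_dep (Acpp K) h q /\
  ev_periodic_dep (Bcp K) h q /\
  ev_periodic_dep (Ccs K) h q /\
  ev_periodic_dep (Ccp K) h q /\
  ev_periodic_dep (Dc K) h q.

Definition admissible p (delta : nat -> 'I_p -> R) : Prop :=
  forall k i, `|delta k i| <= 1.

Definition DeltaM p (m : 'I_p -> nat) (delta : nat -> 'I_p -> R) (k : nat)
  : 'M[R]_(\sum_(i < p) m i) := \mxdiag_(i < p) ((delta k i)%:M : 'M[R]_(m i)).

Record cl_signals (nx p : nat) (m : 'I_p -> nat) (nd ne nu ny : nat) (K : @controller p nu ny) :=
  ClSignals {
  sz   : nat -> 'cV[R]_nx;
  sth  : nat -> 'cV[R]_(\sum_(i < p) m i);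
  sphi : nat -> 'cV[R]_(\sum_(i < p) m i);
  su   : nat -> 'cV[R]_nu;
  se   : nat -> 'cV[R]_ne;
  sy   : nat -> 'cV[R]_ny;
  szc  : forall k : nat, 'cV[R]_(nc K k);
  sthc : forall k : nat, 'cV[R]_(\sum_(i < p) mc K k i);
  sphic : forall k : nat, 'cV[R]_(\sum_(i < p) mc K k i)
}.

Definition cl_traj nx p m nd ne nu ny (G : @plant nx p m nd ne nu ny)
  (K : @controller p nu ny) (delta : nat -> 'I_p -> R) (z0 : 'cV[R]_nx)
  (d : nat -> 'cV[R]_nd) (s : @cl_signals nx p m nd ne nu ny K) : Prop :=
  sz s 0%N = z0 /\ szc s 0%N = 0 /\
  forall k,
  [/\ sz s k.+1 = Ass G k *m sz s k + Asp G k *m sth s k + B1s G k *m d k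
                  + B2s G k *m su s k,
      sphi s k = Aps G k *m sz s k + App G k *m sth s k + B1p G k *m d k
                  + B2p G k *m su s k,
      se s k = C1s G k *m sz s k + C1p G k *m sth s k + D11 G k *m d k
                  + D12 G k *m su s k,
      sy s k = C2s G k *m sz s k + C2p G k *m sth s k + D21 G k *m d k &
      sth s k = DeltaM m delta k *m sphi s k] /\
   [/\ szc s k.+1 = Acss K k *m szc s k + Acsp K k *m sthc s k + Bcs K k *m sy s k,
       sphic s k = Acps K k *m szc s k + Acpp K k *m sthc s k + Bcp K k *m sy s k,
       su s k = Ccs K k *m szc s k + Ccp K k *m sthc s k + Dc K k *m sy s k &
       sthc s k = DeltaM (mc K k) delta k *m sphic s k].

Definition cl_wellposed nx p m nd ne nu ny (G : @plant nx p m nd ne nu ny)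
  (K : @controller p nu ny) : Prop :=
  forall delta, admissible delta -> forall (z0 : 'cV[R]_nx) (d : nat -> 'cV[R]_nd),
  exists! s : @cl_signals nx p m nd ne nu ny K, @cl_traj nx p m nd ne nu ny G K delta z0 d s.

Definition cl_worst_gain nx p m nd ne nu ny (G : @plant nx p m nd ne nu ny)
  (K : @controller p nu ny) a (sd : 'I_a -> nat)
  (Gamma : 'M[R]_(nx, \sum_(i < a) sd i)) : \bar R :=
  ereal_sup [set l2norm (se s) | s in
    [set s : @cl_signals nx p m nd ne nu ny K |
      exists (xi : forall i : 'I_a, 'cV[R]_(sd i)) (d : nat -> 'cV[R]_nd) delta,
        [/\ forall i, vnorm (xi i) <= 1, (l2norm d <= 1)%E, admissible delta &
            @cl_traj nx p m nd ne nu ny G K delta (Gamma *m (\mxcol_(i < a) xi i)) d s]]].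

Definition perext T (hb q : nat) (F : nat -> T) (j : nat) : T :=
  if j == (hb + q)%N then F hb else F j.

End Defs.

(* Main.v *)
Require Import Defs.
From HB Require Import structures.
From mathcomp Require Import all_boot all_order all_algebra.
From mathcomp Require Import all_classical all_reals all_analysis.
From mathcomp Require Import ring lra zify.
Import Order.TTheory GRing.Theory Num.Theory.
Local Open Scope ring_scope.

(** Scaling [S], [t], [f1], [f2] by a constant slightly larger than 1 makes the
coupling [R^-1 <= S] strict.  The controller has the dimensions of the plant,
and the closed loop is certified by the storage functions
  [x^T R^-1 x + (x - xc)^T (S - R^-1) (x - xc)],
one for the states (time-varying) and one for the scheduling channels.  Their
value at [xc = 0] is [x^T S x], and minimizing over [xc] leaves [x^T R^-1 x].
At each time the strict dissipation inequality is to be achieved by an output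
feedback [u = Theta y].  It holds with [u = 0] on the kernel of the output map
(the inequality in [S]), and at every [x] some [u] depending on [x] achieves it
(the inequality in [R], by duality); the saddle point of the resulting
convex-concave quadratic form is linear in [y] and provides [Theta].
Strictness on the scheduling channels makes the loop well posed, and summing
over time gives [|e|^2 <= b (f1 + f2) <= ((b + f1 + f2) / 2)^2]. *)

Set Implicit Arguments.
Unset Strict Implicit.
Unset Printing Implicit Defensive.

(** * Quadratic forms and elimination of the controller matrix *)

Section QuadraticForms.
Variable R : realType.

Definition bilin {n l} (A : 'M[R]_(n, l)) (x : 'cV[R]_n) (y : 'cV[R]_l) : R :=
  (x^T *m A *m y) 0 0.
Definition qform {n} (A : 'M[R]_n) (x : 'cV[R]_n) : R := bilin A x x.

Lemma bilinDl n l (A : 'M[R]_(n, l)) x x' y :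
  bilin A (x + x') y = bilin A x y + bilin A x' y.
Proof. by rewrite /bilin linearD /= !mulmxDl mxE. Qed.

Lemma bilinDr n l (A : 'M[R]_(n, l)) x y y' :
  bilin A x (y + y') = bilin A x y + bilin A x y'.
Proof. by rewrite /bilin mulmxDr mxE. Qed.

Lemma bilinNl n l (A : 'M[R]_(n, l)) x y : bilin A (- x) y = - bilin A x y.
Proof. by rewrite /bilin linearN /= !mulNmx mxE. Qed.

Lemma bilinNr n l (A : 'M[R]_(n, l)) x y : bilin A x (- y) = - bilin A x y.
Proof. by rewrite /bilin mulmxN mxE. Qed.

Lemma bilin_tr n l (A : 'M[R]_(n, l)) x y : bilin A x y = bilin A^T y x.
Proof.
rewrite /bilin -[in LHS](trmxK (x^T *m A *m y)) mxE.
by rewrite !trmx_mul trmxK mulmxA.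
Qed.

Lemma bilin_sym n (A : 'M[R]_n) x y : A^T = A -> bilin A x y = bilin A y x.
Proof. by move=> As; rewrite bilin_tr As. Qed.

Lemma bilin_mul n1 l1 n2 l2 (A : 'M[R]_(n1, l1)) (B : 'M[R]_(n1, n2))
    (C : 'M[R]_(l1, l2)) x y :
  bilin A (B *m x) (C *m y) = bilin (B^T *m A *m C) x y.
Proof. by rewrite /bilin trmx_mul !mulmxA. Qed.

Lemma bilin_addmx n l (A B : 'M[R]_(n, l)) x y :
  bilin (A + B) x y = bilin A x y + bilin B x y.
Proof. by rewrite /bilin mulmxDr mulmxDl mxE. Qed.

Lemma bilin_oppmx n l (A : 'M[R]_(n, l)) x y : bilin (- A) x y = - bilin A x y.
Proof. by rewrite /bilin mulmxN mulNmx mxE. Qed.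

Lemma bilin_scale n l c (A : 'M[R]_(n, l)) x y :
  bilin (c *: A) x y = c * bilin A x y.
Proof. by rewrite /bilin -scalemxAr -scalemxAl mxE. Qed.

Lemma bilin_eq0r n l (A : 'M[R]_(n, l)) x y : A *m y = 0 -> bilin A x y = 0.
Proof. by rewrite /bilin -mulmxA => ->; rewrite mulmx0 mxE. Qed.

Lemma bilin0r n l (A : 'M[R]_(n, l)) x : bilin A x 0 = 0.
Proof. by rewrite bilin_eq0r // mulmx0. Qed.

Lemma qformD n (A : 'M[R]_n) x y : A^T = A ->
  qform A (x + y) = qform A x + 2 * bilin A x y + qform A y.
Proof.
move=> As; rewrite /qform !(bilinDl, bilinDr) (bilin_sym y x As).
ring.
Qed.

Lemma qformN n (A : 'M[R]_n) x : qform A (- x) = qform A x.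
Proof. by rewrite /qform bilinNl bilinNr opprK. Qed.

Lemma qform_mul n l (A : 'M[R]_n) (B : 'M[R]_(n, l)) x :
  qform A (B *m x) = qform (B^T *m A *m B) x.
Proof. exact: bilin_mul. Qed.

Lemma qform0 n (A : 'M[R]_n) : qform A 0 = 0.
Proof. by rewrite /qform bilin_eq0r // mulmx0. Qed.

Lemma posdef_sym n (A : 'M[R]_n) : posdef A -> A^T = A.
Proof. by case. Qed.

Lemma posdef_gt0 n (A : 'M[R]_n) x : posdef A -> x != 0 -> 0 < qform A x.
Proof. by case=> _; apply. Qed.

Lemma posdef_ge0 n (A : 'M[R]_n) x : posdef A -> 0 <= qform A x.
Proof.
move=> Ap; have [->|x0] := eqVneq x 0; first by rewrite qform0.
exact/ltW/posdef_gt0.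
Qed.

Lemma posdef_eq0 n (A : 'M[R]_n) x : posdef A -> qform A x = 0 -> x = 0.
Proof.
move=> Ap Ax; apply/eqP; apply/negPn/negP => x0.
by have := posdef_gt0 Ap x0; rewrite Ax ltxx.
Qed.


(** The columns of [cokermx K] lie in the kernel of [K], so [A] kills them. This serves as a
    Fredholm alternative: a system with symmetric matrix is solved by computing its kernel. *)
Lemma submx_ker n l k (A : 'M[R]_(l, n)) (K : 'M[R]_(k, n)) :
  (forall w : 'cV[R]_n, K *m w = 0 -> A *m w = 0) -> (A <= K)%MS.
Proof.
move=> KA; rewrite submxE; apply/eqP/matrixP => i j; rewrite [RHS]mxE.
have /KA : K *m col j (cokermx K) = 0 by rewrite colE mulmxA mulmx_coker mul0mx.
by rewrite colE mulmxA -colE => /matrixP/(_ i 0); rewrite !mxE.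
Qed.


(** The gap [phi x u] to be made positive is concave in [u] and, at [u = 0], positive on the nonzero
    vectors of [Ker C]. Its saddle point with [C x] prescribed solves a linear system, and the [u]
    part of a solution linear in [C x] gives [Theta]. *)
Lemma strict_elimination N K r l (V : 'M[R]_N) (W : 'M[R]_K)
    (M : 'M[R]_(K, N)) (U : 'M[R]_(K, r)) (C : 'M[R]_(l, N)) :
  V^T = V -> posdef W ->
  (forall x, x != 0 -> C *m x = 0 -> qform W (M *m x) < qform V x) ->
  (forall x, x != 0 -> exists u, qform W (M *m x + U *m u) < qform V x) ->
  exists Theta : 'M[R]_(r, l),
    forall x, x != 0 -> qform W ((M + U *m Theta *m C) *m x) < qform V x.
Proof.
move=> Vs Wp HC HU; have Ws := posdef_sym Wp.
pose P := V - M^T *m W *m M.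
pose Q := - (M^T *m W *m U).
pose D := U^T *m W *m U.
have Ps : P^T = P by rewrite /P linearB /= !trmx_mul trmxK Ws Vs mulmxA.
have Ds : D^T = D by rewrite /D !trmx_mul trmxK Ws mulmxA.
pose phi x u := qform P x + 2 * bilin Q x u - qform D u.
have phiE x u : qform V x - qform W (M *m x + U *m u) = phi x u.
  rewrite /phi qformD // !qform_mul bilin_mul /P /Q /D /qform.
  by rewrite bilin_addmx !bilin_oppmx; ring.
have PE x : qform V x - qform W (M *m x) = qform P x.
  by have := phiE x 0; rewrite /phi mulmx0 addr0 bilin0r qform0; lra.
have D0 u : qform D u = 0 -> U *m u = 0.
  by rewrite /D -qform_mul => /(posdef_eq0 Wp).
have Dge0 u : 0 <= qform D u by rewrite /D -qform_mul posdef_ge0.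
(* KKT matrix of the saddle problem; the last block carries the multiplier of the constraint on
   [C x]. *)
pose S := block_mx (block_mx P Q Q^T (- D)) (col_mx C^T 0) (row_mx C 0) 0.
have Ss : S^T = S.
  have DNs : (- D)^T = - D by rewrite linearN /= Ds.
  rewrite /S !(tr_block_mx, tr_row_mx, tr_col_mx) !trmxK Ps DNs.
  by rewrite !trmx0.
(* Solvability of [S Z^T = (0, 0, C)]: since [S] is symmetric, it suffices that every kernel vector
   [(x, u, lam)] has [C^T lam = 0], which follows once [x = 0] and [U u = 0]. *)
have /submxP[Z] : ((col_mx (0 : 'M[R]_(N + r, N)) C)^T <= S)%MS.
  apply: submx_ker => w.
  rewrite -[w]vsubmxK; move: (usubmx w) (dsubmx w) => xu lam {w}.
  rewrite -[xu]vsubmxK; move: (usubmx xu) (dsubmx xu) => x u {xu}.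
  rewrite /S !mul_block_col mul_row_col mul0mx !mul_col_mx mul0mx.
  rewrite add_col_mx -col_mx0 => /eq_col_mx[].
  rewrite -col_mx0 => /eq_col_mx[] PQ QD; rewrite mul0mx !addr0 in QD *.
  move=> Cx.
  (* Pairing the stationarity equations with [x] and [u] gives [qform P x = - qform D u <= 0], while
     [P] is positive on the nonzero vectors of [Ker C]. *)
  have xPx : qform P x + bilin Q x u = 0.
    have /(congr1 (mulmx x^T)) := PQ; rewrite !mulmxDr mulmx0 !mulmxA.
    rewrite -trmx_mul Cx trmx0 mul0mx addr0 => /matrixP/(_ 0 0).
    by rewrite mxE [RHS]mxE.
  have uDu : bilin Q x u - qform D u = 0.
    have /(congr1 (mulmx u^T)) := QD; rewrite mulNmx !mulmxBr mulmx0 !mulmxA.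
    rewrite bilin_tr => /matrixP/(_ 0 0); rewrite mxE [RHS]mxE => <-.
    by rewrite [X in _ = _ + X]mxE /qform /bilin /D !mulmxA.
  have x0 : x = 0.
    apply/eqP; apply/negPn/negP => x0; have := HC x x0 Cx.
    by have := PE x; have := Dge0 u; lra.
  have Uu : U *m u = 0 by apply: D0; move: xPx uDu; rewrite x0 qform0; lra.
  have Qu : Q *m u = 0 by rewrite /Q mulNmx -(mulmxA _ U) Uu mulmx0 oppr0.
  rewrite tr_col_mx trmx0 mul_row_col mul0mx add0r.
  by move: PQ; rewrite Qu x0 mulmx0 !add0r.
move/(congr1 trmx); rewrite trmxK trmx_mul Ss.
rewrite -[Z^T]vsubmxK; move: (usubmx Z^T) (dsubmx Z^T) => XT Lam {Z}.
rewrite -[XT]vsubmxK; move: (usubmx XT) (dsubmx XT) => X T {XT}.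
rewrite /S !mul_block_col mul_row_col mul0mx !mul_col_mx mul0mx.
rewrite add_col_mx addr0 => /eq_col_mx[].
rewrite -col_mx0 => /eq_col_mx[] PQ QD; rewrite mul0mx !addr0 in QD *.
(* For every [w], the pair [(X w, T w)] is stationary and [C X w = C w]. Choosing [w] from [C x] by
   the pseudo-inverse makes the input a function of [C x] alone. *)
move=> CX; exists (T *m pinvmx C) => x x_neq0.
have [w wE Cw] : exists2 w, w = pinvmx C *m (C *m x) & C *m w = C *m x.
  by exists (pinvmx C *m (C *m x)); rewrite // 2!mulmxA mulmxKpV.
pose xs := X *m w; pose us := T *m w.
have Cxs : C *m xs = C *m x by rewrite /xs mulmxA -CX.
have saddle_x : P *m xs + Q *m us = - (C^T *m (Lam *m w)).
  rewrite /xs /us !mulmxA -!mulmxDl -mulNmx; congr (_ *m w).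
  by apply/eqP; rewrite -addr_eq0 PQ.
have saddle_u : Q^T *m xs = D *m us.
  by rewrite /xs /us !mulmxA; congr (_ *m w); apply/eqP; rewrite -subr_eq0 -mulNmx QD.
have [n xE Cn] : exists2 n, x = xs + n & C *m n = 0.
  by exists (x - xs); rewrite ?mulmxBr ?Cxs ?subrr // addrC subrK.
have -> : (M + U *m (T *m pinvmx C) *m C) *m x = M *m x + U *m us.
  by rewrite mulmxDl /us wE !mulmxA.
rewrite -subr_gt0 phiE.
(* The cross term pairs [n] with the gradient in [x], which lies in the range of [C^T], while
   [C n = 0]. *)
have -> : phi x us = phi xs us + qform P n.
  rewrite [in LHS]xE.
  have : bilin P n xs + bilin Q n us = 0.
    rewrite /bilin -!mulmxA.
    have -> (a b : 'M[R]_1) : a 0 0 + b 0 0 = (a + b) 0 0 by rewrite mxE.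
    by rewrite -mulmxDr saddle_x mulmxN mulmxA -trmx_mul Cn trmx0 mul0mx !mxE oppr0.
  by rewrite /phi qformD // bilinDl (bilin_sym xs n Ps); lra.
have phi_max u : phi xs u <= phi xs us.
  have Dus : bilin D us us = bilin Q xs us.
    by rewrite [RHS]bilin_tr /bilin -[in RHS]mulmxA saddle_u mulmxA.
  have Du v : bilin Q xs v = bilin D us v.
    by rewrite bilin_tr /bilin -mulmxA saddle_u mulmxA -/(bilin _ _ _) bilin_sym.
  have := Dge0 (u - us); rewrite qformD // qformN bilinNr (bilin_sym u us Ds) -Du.
  by rewrite /phi Du /qform; lra.
have n_ge0 : 0 <= qform P n.
  have [->|n0] := eqVneq n 0; first by rewrite qform0.
  by have := HC n n0 Cn; have := PE n; lra.
(* If [xs] is nonzero, [HU] makes the maximum [phi xs us] positive. If [xs = 0], then [x = n] lies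
   in [Ker C] and [HC] gives positivity. *)
have [xs0|xs0] := eqVneq xs 0; last first.
  have [u] := HU xs xs0; rewrite -subr_gt0 phiE => phi_gt0.
  by have := phi_max u; lra.
have nx : n = x by rewrite xE xs0 add0r.
have := HC n; rewrite nx => /(_ x_neq0); rewrite -{1}nx => /(_ Cn).
have := PE x; have := phi_max 0; rewrite {1}/phi bilin0r qform0 xs0 qform0.
lra.
Qed.

End QuadraticForms.

(** * Duality and feedback synthesis from storage functions *)

Section Synthesis.
Variable R : realType.

(** These are the normal equations for minimizing [qform A (x + B u)] over [u]; they are solvable
    because [B^T A B w = 0] forces [B w = 0]. *)
Lemma normal_equation n l (A : 'M[R]_n) (B : 'M[R]_(n, l)) (x : 'cV[R]_n) :
  posdef A -> exists u : 'cV[R]_l, B^T *m A *m (x + B *m u) = 0.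
Proof.
move=> Ap; have As := posdef_sym Ap.
have /submxP[Z] : ((B^T *m A *m x)^T <= B^T *m A *m B)%MS.
  apply: submx_ker => w Bw.
  have : qform A (B *m w) = 0.
    by rewrite qform_mul /qform /bilin -(mulmxA w^T) Bw mulmx0 mxE.
  move/(posdef_eq0 Ap) => Bw0.
  by rewrite !trmx_mul trmxK As -!mulmxA Bw0 !mulmx0.
move/(congr1 trmx); rewrite trmxK !trmx_mul trmxK As => BAx.
by exists (- Z^T); rewrite mulmxDr BAx !mulmxN !mulmxA subrr.
Qed.

(** The least-squares [u] gives [v = H x + B u] and [w = Y' v] with [B^T w = 0]. For [y = X H^T w],
    both [bilin Y x y] and [qform Y' v] equal [qform X' w], and [qform Y y] is smaller when [w] is
    nonzero; expanding [0 <= qform Y (x - y)] concludes. *)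
Lemma dual_bound n1 n2 l (H : 'M[R]_(n2, n1)) (B : 'M[R]_(n2, l))
    (X Y : 'M[R]_n1) (X' Y' : 'M[R]_n2) :
  posdef Y -> posdef Y' -> Y *m X = 1%:M -> Y' *m X' = 1%:M ->
  (forall w, w != 0 -> B^T *m w = 0 -> qform (H *m X *m H^T) w < qform X' w) ->
  forall x, x != 0 -> exists u, qform Y' (H *m x + B *m u) < qform Y x.
Proof.
move=> Yp Y'p YX Y'X' HB x x0.
have Y's := posdef_sym Y'p; have Ys := posdef_sym Yp.
have [u Bu] := normal_equation B (H *m x) Y'p; exists u.
pose v := H *m x + B *m u; pose w := Y' *m v.
have vE : X' *m w = v by rewrite mulmxA (mulmx1C Y'X') mul1mx.
have Bw : B^T *m w = 0 by rewrite mulmxA.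
have vv : qform Y' v = bilin 1%:M w v.
  by rewrite /qform /bilin /w trmx_mul Y's mulmx1.
pose y := X *m (H^T *m w).
have Yy : Y *m y = H^T *m w by rewrite mulmxA YX mul1mx.
have ww : qform X' w = bilin 1%:M w v.
  by rewrite /qform /bilin mulmx1 -mulmxA vE.
have yy : qform Y y = qform (H *m X *m H^T) w.
  have -> : qform Y y = bilin 1%:M y (H^T *m w).
    by rewrite /qform /bilin mulmx1 -mulmxA Yy.
  by rewrite bilin_tr trmx1 /qform /bilin mulmx1 trmx_mul trmxK /y !mulmxA.
have xy : bilin Y x y = bilin 1%:M w v.
  rewrite [RHS]bilin_tr trmx1 /v bilinDl /bilin !mulmx1 !trmx_mul.
  rewrite -(mulmxA _ B^T) Bw mulmx0 [X in _ = _ + X]mxE addr0.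
  by rewrite -!mulmxA -Yy.
have [w0|w0] := eqVneq w 0.
  rewrite -/v vv -ww w0 qform0; exact: posdef_gt0.
have := HB w w0 Bw; have := posdef_ge0 (x - y) Yp.
rewrite qformD // qformN bilinNr -/v vv ww xy -yy; lra.
Qed.
(** Only the first [c] coordinates have a controller copy [xc]; the other [e] hold the disturbance
    or the performance output. *)
Definition storage c e (Y : 'M[R]_(c + e)) (P : 'M[R]_c) x xc : R :=
  qform Y x + qform P (usubmx x - xc).

Definition storage_mx c e (Y : 'M[R]_(c + e)) (P : 'M[R]_c) : 'M[R]_(c + e + c) :=
  let E1 : 'M[R]_(c + e, c + e + c) := row_mx 1%:M 0 in
  let E2 : 'M[R]_(c, c + e + c) := row_mx (row_mx 1%:M 0) (- 1%:M) in
  E1^T *m Y *m E1 + E2^T *m P *m E2.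

Lemma qform_storage_mx c e (Y : 'M[R]_(c + e)) P x xc :
  qform (storage_mx Y P) (col_mx x xc) = storage Y P x xc.
Proof.
rewrite /storage_mx /storage /qform bilin_addmx -!bilin_mul.
have -> : row_mx 1%:M 0 *m col_mx x xc = x.
  by rewrite mul_row_col mul1mx mul0mx addr0.
suff -> : row_mx (row_mx 1%:M 0) (- 1%:M) *m col_mx x xc = usubmx x - xc by [].
by rewrite -{1}(vsubmxK x) !mul_row_col mulNmx !mul1mx mul0mx addr0.
Qed.

Lemma posdef_storage_mx c e (Y : 'M[R]_(c + e)) P :
  posdef Y -> posdef P -> posdef (storage_mx Y P).
Proof.
move=> Yp Pp; split.
  by rewrite linearD /= !trmx_mul !trmxK (posdef_sym Yp) (posdef_sym Pp) !mulmxA.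
move=> x x0; rewrite -[_ 0 0]/(qform _ _) -(vsubmxK x) qform_storage_mx.
have [x10|x10] := eqVneq (usubmx x) 0; last first.
  by apply: ltr_wpDr (posdef_gt0 Yp x10); exact: posdef_ge0.
rewrite /storage x10 qform0 add0r linear0 sub0r qformN; apply: posdef_gt0 => //.
by apply: contraNneq x0 => x20; rewrite -(vsubmxK x) x10 x20 col_mx0.
Qed.

(** Static elimination is applied to the augmented vector [(x, xc)] with measurement [(C x, xc)] and
    input [(u, xc')]. The kernel of the measurement has [xc = 0]; in the pointwise condition, taking
    [xc'] equal to the first block of the successor cancels the [P'] term. *)
Lemma synthesis c e e' nu ny (H : 'M[R]_(c + e', c + e)) (B : 'M[R]_(c + e', nu))
    (C : 'M[R]_(ny, c + e)) (Y : 'M[R]_(c + e)) (P : 'M[R]_c)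
    (Y' : 'M[R]_(c + e')) (P' : 'M[R]_c) :
  posdef Y -> posdef P -> posdef Y' -> posdef P' ->
  (forall x, x != 0 -> C *m x = 0 -> storage Y' P' (H *m x) 0 < storage Y P x 0) ->
  (forall x, x != 0 -> exists u, qform Y' (H *m x + B *m u) < qform Y x) ->
  exists Theta : 'M[R]_(nu + c, ny + c), forall x xc w,
    w = Theta *m col_mx (C *m x) xc -> col_mx x xc != 0 ->
    storage Y' P' (H *m x + B *m usubmx w) (dsubmx w) < storage Y P x xc.
Proof.
move=> Yp Pp Y'p P'p HS HR.
pose M : 'M[R]_(c + e' + c, c + e + c) := block_mx H 0 0 0.
pose U : 'M[R]_(c + e' + c, nu + c) := block_mx B 0 0 1%:M.
pose Ce : 'M[R]_(ny + c, c + e + c) := block_mx C 0 0 1%:M.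
have Mx x xc : M *m col_mx x xc = col_mx (H *m x) 0.
  by rewrite mul_block_col !mul0mx !addr0.
have Uu u uc : U *m col_mx u uc = col_mx (B *m u) uc.
  by rewrite mul_block_col !mul0mx mul1mx addr0 add0r.
have Cx x xc : Ce *m col_mx x xc = col_mx (C *m x) xc.
  by rewrite mul_block_col !mul0mx mul1mx addr0 add0r.
have [||x x0|x x0|Theta HT] := @strict_elimination R _ _ _ _ (storage_mx Y P)
  (storage_mx Y' P') M U Ce.
- exact/posdef_sym/posdef_storage_mx.
- exact: posdef_storage_mx.
- move: x0; rewrite -(vsubmxK x) Cx Mx -col_mx0 => x0 /eq_col_mx[Cx0 xc0].
  rewrite !qform_storage_mx xc0; apply: HS Cx0.
  by apply: contraNneq x0 => ->; rewrite xc0 col_mx0.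
- move: x0; rewrite -(vsubmxK x) Mx => x0.
  have [x10|x10] := eqVneq (usubmx x) 0.
    exists 0; rewrite x10 !mulmx0 addr0 col_mx0 qform0.
    apply: posdef_gt0; first exact: posdef_storage_mx.
    by rewrite -x10.
  have [u Hu] := HR _ x10; exists (col_mx u (usubmx (H *m usubmx x + B *m u))).
  rewrite Uu add_col_mx add0r !qform_storage_mx {1}/storage subrr qform0 addr0.
  by apply: lt_le_trans Hu _; rewrite lerDl; exact: posdef_ge0.
exists Theta => x xc w wE x0; have := HT _ x0.
rewrite mulmxDl Mx -!mulmxA Cx -wE -[w in U *m w](vsubmxK w) Uu add_col_mx add0r.
by rewrite !qform_storage_mx.
Qed.

End Synthesis.

(** * Synthesis at one time step *)

Section StepSynthesis.
Variable R : realType.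

Lemma qform_block_diag n l (A : 'M[R]_n) (B : 'M[R]_l) x y :
  qform (block_mx A 0 0 B) (col_mx x y) = qform A x + qform B y.
Proof.
rewrite /qform /bilin tr_col_mx -!mulmxA mul_block_col !mul0mx addr0 add0r.
by rewrite mul_row_col mxE.
Qed.

Lemma qform_diag3 n1 n2 n3 (A : 'M[R]_n1) (B : 'M[R]_n2) (C : 'M[R]_n3) x y z :
  qform (diag3 A B C) (col_mx (col_mx x y) z) = qform A x + qform B y + qform C z.
Proof. by rewrite !qform_block_diag. Qed.

Lemma posdef_block_diag n l (A : 'M[R]_n) (B : 'M[R]_l) :
  posdef A -> posdef B -> posdef (block_mx A 0 0 B).
Proof.
move=> Ap Bp; split.
  by rewrite tr_block_mx !trmx0 (posdef_sym Ap) (posdef_sym Bp).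
move=> x; rewrite -[_ 0 0]/(qform _ _) -(vsubmxK x) qform_block_diag.
have [->|x10] := eqVneq (usubmx x) 0; last first.
  by move=> _; apply: ltr_wpDr (posdef_gt0 Ap x10); exact: posdef_ge0.
have [->|x20] := eqVneq (dsubmx x) 0; first by rewrite col_mx0 eqxx.
by move=> _; rewrite qform0 add0r; exact: posdef_gt0.
Qed.

Lemma qform_scalar n c (x : 'cV[R]_n) : qform c%:M x = c * qform 1%:M x.
Proof. by rewrite -(scalemx1 _ c) /qform bilin_scale. Qed.

Lemma qform1 n (x : 'cV[R]_n) : qform 1%:M x = \sum_(j < n) x j 0 ^+ 2.
Proof.
rewrite /qform /bilin mulmx1 mxE; apply: eq_bigr => j _.
by rewrite mxE expr2.
Qed.

Lemma qform1_ge0 n (x : 'cV[R]_n) : 0 <= qform 1%:M x.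
Proof. by rewrite qform1; apply: sumr_ge0 => j _; exact: sqr_ge0. Qed.

Lemma posdef_scalar n c : 0 < c -> posdef (c%:M : 'M[R]_n).
Proof.
move=> c0; split=> [|x]; first exact: tr_scalar_mx.
rewrite -[_ 0 0]/(qform _ _) qform_scalar => x0; apply: mulr_gt0 => //.
rewrite lt_neqAle qform1_ge0 andbT eq_sym qform1 psumr_eq0; last first.
  by move=> j _; exact: sqr_ge0.
apply: contraNN x0 => /allP x0; apply/eqP/matrixP => i j; rewrite (ord1 j) !mxE.
by apply/eqP; rewrite -sqrf_eq0; apply: x0; rewrite mem_index_enum.
Qed.

Lemma posdef_unitmx n (A : 'M[R]_n) : posdef A -> A \in unitmx.
Proof.
move=> Ap; rewrite -row_full_unit -sub1mx; apply: submx_ker => w Aw.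
by rewrite mul1mx; apply: (posdef_eq0 Ap); rewrite /qform bilin_eq0r.
Qed.

Lemma posdef_invmx n (A : 'M[R]_n) : posdef A -> posdef (invmx A).
Proof.
move=> Ap; have Au := posdef_unitmx Ap; have As := posdef_sym Ap.
split=> [|x x0]; first by rewrite trmx_inv As.
have := posdef_gt0 (x := invmx A *m x) Ap.
rewrite qform_mul trmx_inv As mulVmx // mul1mx; apply.
by apply: contraNneq x0 => Ax; rewrite -(mulKVmx Au x) Ax mulmx0.
Qed.

(* Evaluate the coupling matrix at [(- A^-1 x, x)]. *)
Lemma coupling_ge n (A B : 'M[R]_n) x : posdef A ->
  possemidef (block_mx A 1%:M 1%:M B) -> qform (invmx A) x <= qform B x.
Proof.
move=> Ap [_ /(_ (col_mx (- (invmx A *m x)) x))].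
have Au := posdef_unitmx Ap; have As := posdef_sym Ap.
rewrite tr_col_mx -mulmxA mul_block_col !mul1mx mulmxN mulKVmx // addNr.
rewrite mul_row_col mulmx0 add0r mulmxDr mulmxN !mulmxA.
by rewrite mxE [X in X + _]mxE; rewrite -/(bilin _ _ _) addrC subr_ge0.
Qed.

Lemma posdef_coupling c n (A B : 'M[R]_n) : 1 < c -> posdef A -> posdef B ->
  possemidef (block_mx A 1%:M 1%:M B) -> posdef (c *: B - invmx A).
Proof.
move=> c1 Ap Bp AB; split=> [|x x0].
  by rewrite linearB linearZ /= (posdef_sym Bp) (posdef_sym (posdef_invmx Ap)).
rewrite -[_ 0 0]/(bilin _ _ _) bilin_addmx bilin_oppmx bilin_scale subr_gt0.
apply: le_lt_trans (coupling_ge x Ap AB) _.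
by rewrite ltr_pMl //; exact: posdef_gt0.
Qed.

Lemma coupling_scalar (x y : R) : 0 < x ->
  possemidef (block_mx (x%:M : 'M[R]_1) 1 1 (y%:M : 'M[R]_1)) -> x^-1 <= y.
Proof.
move=> x0 /(coupling_ge (const_mx 1) (posdef_scalar _ x0)).
rewrite invmx_scalar 2!qform_scalar qform1 big_ord1 mxE.
by rewrite expr1n !mulr1.
Qed.

Lemma negdef_on_ker n r l (N : 'M[R]_(n, r)) (Q : 'M[R]_(l, n)) (A B : 'M[R]_n) :
  im_eq_ker N Q -> negdef (N^T *m (A - B) *m N) ->
  forall x, x != 0 -> Q *m x = 0 -> qform A x < qform B x.
Proof.
move=> NQ [_ NAB] x x0 /NQ [y xy]; have /NAB : y != 0.
  by apply: contraNneq x0 => y0; rewrite xy y0 mulmx0.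
rewrite -[_ 0 0]/(bilin _ _ _) bilin_oppmx -/(qform _ _) -qform_mul -xy.
by rewrite /qform bilin_addmx bilin_oppmx opprB subr_gt0.
Qed.

(** At [xc = 0] the storages are the [S] forms, which gives the kernel condition of [synthesis]; its
    pointwise condition is dual to the inequality in [X0]. The scalar bounds allow [f^-1] and [b^-1]
    to replace [g] and [t]. *)
Lemma step_synthesis n l nd ne nu ny
    (H : 'M[R]_(n + l + ne, n + l + nd)) (B : 'M[R]_(n + l + ne, nu))
    (C : 'M[R]_(ny, n + l + nd)) (X0 S0 X0' S0' : 'M[R]_n) (Xb Sb : 'M[R]_l)
    (Yb : 'M[R]_l) (b f g t : R) :
  posdef X0 -> posdef X0' -> posdef Yb -> Yb *m Xb = 1%:M ->
  posdef (S0 - invmx X0) -> posdef (S0' - invmx X0') -> posdef (Sb - Yb) ->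
  0 < b -> 0 < f -> f^-1 <= g -> b^-1 <= t ->
  (forall x, x != 0 -> C *m x = 0 ->
    qform (diag3 S0' Sb t%:M) (H *m x) < qform (diag3 S0 Sb f%:M) x) ->
  (forall w, w != 0 -> B^T *m w = 0 ->
    qform (diag3 X0 Xb g%:M) (H^T *m w) < qform (diag3 X0' Xb b%:M) w) ->
  exists Theta : 'M[R]_(nu + (n + l), ny + (n + l)), forall x xc w,
    w = Theta *m col_mx (C *m x) xc -> col_mx x xc != 0 ->
    storage (diag3 (invmx X0') Yb (b^-1)%:M)
      (block_mx (S0' - invmx X0') 0 0 (Sb - Yb))
      (H *m x + B *m usubmx w) (dsubmx w) <
    storage (diag3 (invmx X0) Yb f%:M)
      (block_mx (S0 - invmx X0) 0 0 (Sb - Yb)) x xc.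
Proof.
move=> X0p X0'p Ybp YXb P0p P0'p Pbp b0 f0 fg bt HS HR.
have Y0p := posdef_invmx X0p; have Y0'p := posdef_invmx X0'p.
have storage0 k (T : 'M[R]_n) (A : 'M[R]_n) (r : R) (x : 'cV[R]_(n + l + k)) :
    storage (diag3 A Yb r%:M) (block_mx (T - A) 0 0 (Sb - Yb)) x 0 =
    qform (diag3 T Sb r%:M) x.
  rewrite /storage subr0 -(vsubmxK x) col_mxKu -(vsubmxK (usubmx x)).
  rewrite !qform_diag3 qform_block_diag /qform !bilin_addmx !bilin_oppmx.
  ring.
apply: synthesis => [||||x x0 Cx|].
- by apply: posdef_block_diag; [exact: posdef_block_diag|exact: posdef_scalar].
- exact: posdef_block_diag.
- apply: posdef_block_diag; first exact: posdef_block_diag.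
  by apply: posdef_scalar; rewrite invr_gt0.
- exact: posdef_block_diag.
- rewrite !storage0; apply: le_lt_trans (HS x x0 Cx).
  rewrite -(vsubmxK (H *m x)) -(vsubmxK (usubmx (H *m x))) !qform_diag3 lerD2l.
  by rewrite 2!qform_scalar ler_wpM2r // qform1_ge0.
- apply: (@dual_bound _ _ _ _ _ _ (diag3 X0 Xb (f^-1)%:M) _ (diag3 X0' Xb b%:M)).
  + by apply: posdef_block_diag; [exact: posdef_block_diag|exact: posdef_scalar].
  + apply: posdef_block_diag; first exact: posdef_block_diag.
    by apply: posdef_scalar; rewrite invr_gt0.
  + rewrite !mulmx_block !mulmx0 !mul0mx !addr0 !add0r mulVmx ?posdef_unitmx // YXb.
    by rewrite -!scalar_mx_block -scalar_mxM mulfV ?gt_eqF // -scalar_mx_block.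
  + rewrite !mulmx_block !mulmx0 !mul0mx !addr0 !add0r mulVmx ?posdef_unitmx // YXb.
    by rewrite -!scalar_mx_block -scalar_mxM mulVf ?gt_eqF // -scalar_mx_block.
  + move=> w w0 Bw; apply: le_lt_trans (HR w w0 Bw).
    rewrite -{1}(trmxK H) -qform_mul.
    rewrite -(vsubmxK (H^T *m w)) -(vsubmxK (usubmx (H^T *m w))) !qform_diag3 lerD2l.
    by rewrite 2!qform_scalar ler_wpM2r // qform1_ge0.
Qed.

Definition block_storage n (Y P : 'M[R]_n) (z zc : 'cV[R]_n) : R :=
  qform Y z + qform P (z - zc).

Lemma storage_blocks n l k (Y0 P0 : 'M[R]_n) (Yb Pb : 'M[R]_l) r z th (d : 'cV_k) zc thc :
  storage (diag3 Y0 Yb r%:M) (block_mx P0 0 0 Pb)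
    (col_mx (col_mx z th) d) (col_mx zc thc) =
  block_storage Y0 P0 z zc + block_storage Yb Pb th thc + r * qform 1%:M d.
Proof.
rewrite /storage qform_diag3 col_mxKu opp_col_mx add_col_mx qform_block_diag.
by rewrite qform_scalar /block_storage; ring.
Qed.

End StepSynthesis.

(** * Block-diagonal forms and the uncertainty *)

Section BlockDiagonal.
Variables (R : realType) (p : nat) (m : 'I_p -> nat).

Lemma qform_mxdiag (B : forall i, 'M[R]_(m i)) (x : 'cV[R]_(\sum_i m i)) :
  qform (\mxdiag_i B i) x = \sum_i qform (B i) (submxcol x i).
Proof.
rewrite -{1}(submxcolK x) /qform /bilin tr_mxcol mul_mxrow_mxdiag mul_mxrow_mxcol.
by rewrite summxE.
Qed.

Lemma posdef_mxdiag (B : forall i, 'M[R]_(m i)) :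
  (forall i, posdef (B i)) -> posdef (\mxdiag_i B i).
Proof.
move=> Bp; split.
  by rewrite tr_mxdiag; apply: eq_mxdiag => i; exact: posdef_sym.
move=> x x0; rewrite -[_ 0 0]/(qform _ _) qform_mxdiag lt_neqAle eq_sym.
rewrite psumr_eq0 => [|i _]; last exact: posdef_ge0.
rewrite sumr_ge0 ?andbT => [|i _]; last exact: posdef_ge0.
apply: contraNN x0 => /allP x0; rewrite -(submxcolK x); apply/eqP.
rewrite -[RHS]mxcol0; apply: eq_mxcol => i; apply: (posdef_eq0 (Bp i)).
by apply/eqP/x0; rewrite mem_index_enum.
Qed.

Lemma mxdiag_invK (B : forall i, 'M[R]_(m i)) :
  (forall i, posdef (B i)) -> \mxdiag_i invmx (B i) *m \mxdiag_i B i = 1%:M.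
Proof.
move=> Bp; rewrite [X in _ *m X]/mxdiag mul_mxdiag_mxblock -mxdiagZ.
apply: eq_mxblock => i j; case: eqVneq => [<-|_]; last by rewrite mulmx0.
by rewrite !conform_mx_id mulVmx // posdef_unitmx.
Qed.

(** On block [i] the uncertainty is a scalar, so it commutes with [B i] and multiplies its form by
    [delta k i ^+ 2 <= 1]. *)
Lemma DeltaM_contraction (B : forall i, 'M[R]_(m i)) delta k x :
  admissible delta -> (forall i, posdef (B i)) ->
  qform (\mxdiag_i B i) (DeltaM m delta k *m x) <= qform (\mxdiag_i B i) x.
Proof.
move=> ad Bp; rewrite -(submxcolK x) /DeltaM mul_mxdiag_mxcol !qform_mxdiag.
apply: ler_sum => i _; rewrite !mxcolK mul_scalar_mx /qform /bilin.
rewrite -scalemxAr linearZ /= -!scalemxAl scalerA mxE.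
rewrite ler_piMl //; first exact: posdef_ge0.
by rewrite -expr2 -real_normK ?num_real // expr_le1.
Qed.

End BlockDiagonal.

(** * The closed loop *)

(** Matrix products are generalized so that only sums of entries remain for [ring]. *)
Ltac mx_ac :=
  repeat match goal with |- context [@mulmx ?S ?a ?b ?c ?A ?B] =>
    let X := fresh "X" in generalize (@mulmx S a b c A B) => X end;
  let i := fresh "i" in let j := fresh "j" in
  apply/matrixP => i j; rewrite !mxE; ring.

Section ClosedLoop.
Variables (R : realType) (nx p : nat) (m : 'I_p -> nat) (nd ne nu ny : nat).
Variable G : plant R nx m nd ne nu ny.
Let l := (\sum_(i < p) m i)%N.

(** [Th k] maps [(y, zc, thc)] to [(u, zc', phic)], with [zc'] the next controller state; the
    controller matrices are its blocks. The dimensions are constant in time. *)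
Definition controller_of (Th : nat -> 'M[R]_(nu + (nx + l), ny + (nx + l))) :
    controller R p nu ny :=
  @Controller R p nu ny (fun=> nx) (fun=> m)
    (fun k => ulsubmx (drsubmx (Th k))) (fun k => ursubmx (drsubmx (Th k)))
    (fun k => usubmx (dlsubmx (Th k)))
    (fun k => dlsubmx (drsubmx (Th k))) (fun k => drsubmx (drsubmx (Th k)))
    (fun k => dsubmx (dlsubmx (Th k)))
    (fun k => lsubmx (ursubmx (Th k))) (fun k => rsubmx (ursubmx (Th k)))
    (fun k => ulsubmx (Th k)).

Variable Th : nat -> 'M[R]_(nu + (nx + l), ny + (nx + l)).
Let K := controller_of Th.

Lemma controller_of_mul k y (zc : 'cV[R]_nx) (thc : 'cV[R]_l) :
  Th k *m col_mx y (col_mx zc thc) =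
  col_mx (Ccs K k *m zc + Ccp K k *m thc + Dc K k *m y)
    (col_mx (Acss K k *m zc + Acsp K k *m thc + Bcs K k *m y)
            (Acps K k *m zc + Acpp K k *m thc + Bcp K k *m y)).
Proof.
rewrite -[Th k in LHS]submxK mul_block_col.
rewrite -[ursubmx (Th k) in LHS]hsubmxK -[dlsubmx (Th k) in LHS]vsubmxK.
rewrite -[drsubmx (Th k) in LHS]submxK mul_row_col mul_col_mx mul_block_col.
by rewrite add_col_mx addrC; congr col_mx; congr col_mx; rewrite addrC.
Qed.

Definition plant_H k : 'M[R]_(nx + l + ne, nx + l + nd) :=
  mx3 (Ass G k) (Asp G k) (B1s G k) (Aps G k) (App G k) (B1p G k)
      (C1s G k) (C1p G k) (D11 G k).
Definition plant_B k : 'M[R]_(nx + l + ne, nu) :=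
  col_mx (col_mx (B2s G k) (B2p G k)) (D12 G k).
Definition plant_C k : 'M[R]_(ny, nx + l + nd) :=
  row3 (C2s G k) (C2p G k) (D21 G k).

Lemma plant_H_mul k (z : 'cV[R]_nx) (th : 'cV[R]_l) (d : 'cV[R]_nd) (u : 'cV[R]_nu) :
  plant_H k *m col_mx (col_mx z th) d + plant_B k *m u =
  col_mx (col_mx (Ass G k *m z + Asp G k *m th + B1s G k *m d + B2s G k *m u)
                 (Aps G k *m z + App G k *m th + B1p G k *m d + B2p G k *m u))
         (C1s G k *m z + C1p G k *m th + D11 G k *m d + D12 G k *m u).
Proof.
rewrite /plant_H /mx3 /plant_B !mul_block_col !mul_col_mx mul_row_col.
by rewrite !add_col_mx.
Qed.

Lemma plant_C_mul k (z : 'cV[R]_nx) (th : 'cV[R]_l) (d : 'cV[R]_nd) :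
  plant_C k *m col_mx (col_mx z th) d = C2s G k *m z + C2p G k *m th + D21 G k *m d.
Proof. by rewrite /plant_C /row3 !mul_row_col. Qed.

(** The map from [(th, thc)] to [(phi, phic)] after eliminating [y] and [u], for zero states and
    disturbance; [loop_input] collects the contribution of those. *)
Definition loop_mx k : 'M[R]_(l + l) :=
  block_mx (App G k + B2p G k *m Dc K k *m C2p G k) (B2p G k *m Ccp K k)
           (Bcp K k *m C2p G k) (Acpp K k).

Definition loop_input k (z zc : 'cV[R]_nx) (d : 'cV[R]_nd) : 'cV[R]_(l + l) :=
  col_mx (Aps G k *m z + B1p G k *m d
          + B2p G k *m (Ccs K k *m zc + Dc K k *m (C2s G k *m z + D21 G k *m d)))
         (Acps K k *m zc + Bcp K k *m (C2s G k *m z + D21 G k *m d)).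

Lemma loop_eq k (z zc : 'cV[R]_nx) (th thc : 'cV[R]_l) (d : 'cV[R]_nd) y u :
  y = C2s G k *m z + C2p G k *m th + D21 G k *m d ->
  u = Ccs K k *m zc + Ccp K k *m thc + Dc K k *m y ->
  col_mx (Aps G k *m z + App G k *m th + B1p G k *m d + B2p G k *m u)
         (Acps K k *m zc + Acpp K k *m thc + Bcp K k *m y) =
  loop_mx k *m col_mx th thc + loop_input k z zc d.
Proof.
move=> -> ->; rewrite /loop_mx /loop_input mul_block_col add_col_mx.
rewrite !(mulmxDr, mulmxDl, mulmxA).
by congr col_mx; rewrite /l /K /=; mx_ac.
Qed.

(** * Dissipation along the closed loop *)

Variables (Y0 P0 : nat -> 'M[R]_nx) (Yb Pb : nat -> forall i, 'M[R]_(m i)).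
Variables b f : R.
Hypotheses (Y0p : forall k, posdef (Y0 k)) (P0p : forall k, posdef (P0 k)).
Hypotheses (Ybp : forall k i, posdef (Yb k i)) (Pbp : forall k i, posdef (Pb k i)).
Hypothesis b_gt0 : 0 < b.
(** The state weights advance to [k.+1], whereas the channel weights stay at [k], because the
    scheduling channels are instantaneous. *)
Hypothesis ThP : forall k x xc w,
  w = Th k *m col_mx (plant_C k *m x) xc -> col_mx x xc != 0 ->
  storage (diag3 (Y0 k.+1) (\mxdiag_i Yb k i) (b^-1)%:M)
    (block_mx (P0 k.+1) 0 0 (\mxdiag_i Pb k i))
    (plant_H k *m x + plant_B k *m usubmx w) (dsubmx w) <
  storage (diag3 (Y0 k) (\mxdiag_i Yb k i) f%:M)
    (block_mx (P0 k) 0 0 (\mxdiag_i Pb k i)) x xc.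

Let V k := block_storage (Y0 k) (P0 k).
Let Vb k : 'cV[R]_l -> 'cV[R]_l -> R :=
  block_storage (\mxdiag_i Yb k i) (\mxdiag_i Pb k i).

Lemma block_storage_ge0 n (Y P : 'M[R]_n) z zc :
  posdef Y -> posdef P -> 0 <= block_storage Y P z zc.
Proof. by move=> Yp Pp; apply: addr_ge0; exact: posdef_ge0. Qed.

Lemma block_storage0 n (Y P : 'M[R]_n) : block_storage Y P 0 0 = 0.
Proof. by rewrite /block_storage subr0 !qform0 addr0. Qed.

Lemma block_storage_contraction k delta phi phic : admissible delta ->
  Vb k (DeltaM m delta k *m phi) (DeltaM m delta k *m phic) <= Vb k phi phic.
Proof.
by move=> ad; rewrite /Vb /block_storage -mulmxBr lerD ?DeltaM_contraction.
Qed.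

Lemma dissipation k (z zc : 'cV[R]_nx) (th thc : 'cV[R]_l) d y u :
  y = C2s G k *m z + C2p G k *m th + D21 G k *m d ->
  u = Ccs K k *m zc + Ccp K k *m thc + Dc K k *m y ->
  col_mx (col_mx (col_mx z th) d) (col_mx zc thc) != 0 ->
  V k.+1 (Ass G k *m z + Asp G k *m th + B1s G k *m d + B2s G k *m u)
    (Acss K k *m zc + Acsp K k *m thc + Bcs K k *m y)
  + Vb k (Aps G k *m z + App G k *m th + B1p G k *m d + B2p G k *m u)
    (Acps K k *m zc + Acpp K k *m thc + Bcp K k *m y)
  + b^-1 * qform 1%:M
     (C1s G k *m z + C1p G k *m th + D11 G k *m d + D12 G k *m u)
  < V k z zc + Vb k th thc + f * qform 1%:M d.
Proof.
move=> yE uE x0; have := ThP (k := k) erefl x0.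
rewrite plant_C_mul -yE controller_of_mul col_mxKu col_mxKd -uE plant_H_mul.
by rewrite !storage_blocks.
Qed.

Lemma dissipation_le k (z zc : 'cV[R]_nx) (th thc : 'cV[R]_l) d y u :
  y = C2s G k *m z + C2p G k *m th + D21 G k *m d ->
  u = Ccs K k *m zc + Ccp K k *m thc + Dc K k *m y ->
  V k.+1 (Ass G k *m z + Asp G k *m th + B1s G k *m d + B2s G k *m u)
    (Acss K k *m zc + Acsp K k *m thc + Bcs K k *m y)
  + Vb k (Aps G k *m z + App G k *m th + B1p G k *m d + B2p G k *m u)
    (Acps K k *m zc + Acpp K k *m thc + Bcp K k *m y)
  + b^-1 * qform 1%:M
     (C1s G k *m z + C1p G k *m th + D11 G k *m d + D12 G k *m u)
  <= V k z zc + Vb k th thc + f * qform 1%:M d.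
Proof.
have [|x0] := eqVneq (col_mx (col_mx (col_mx z th) d) (col_mx zc thc)) 0;
  last by move=> yE uE; exact/ltW/dissipation.
rewrite -!col_mx0 => /eq_col_mx[/eq_col_mx[/eq_col_mx[-> ->] ->] /eq_col_mx[-> ->]].
rewrite !(mulmx0, addr0) => -> ->; rewrite !(mulmx0, addr0).
by rewrite /V /Vb !block_storage0 !qform0 !mulr0.
Qed.

(** * Existence and uniqueness of closed-loop trajectories *)

Section Trajectories.
Variable delta : nat -> 'I_p -> R.
Hypothesis ad : admissible delta.

Let De k : 'M[R]_(l + l) := block_mx (DeltaM m delta k) 0 0 (DeltaM m delta k).

(** A nonzero kernel vector [(th, thc)] would solve the loop with zero states and disturbance.
    Strict dissipation then gives [Vb phi phic < Vb th thc], against the contraction by the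
    uncertainty. *)
Lemma loop_unit k : 1%:M - De k *m loop_mx k \in unitmx.
Proof.
rewrite -row_full_unit -sub1mx; apply: submx_ker => w.
rewrite mul1mx mulmxBl mul1mx -mulmxA => /subr0_eq.
rewrite -{1 3}(vsubmxK w); move: (usubmx w) (dsubmx w) (vsubmxK w) => th thc <- {w}.
pose y := C2s G k *m (0 : 'cV[R]_nx) + C2p G k *m th + D21 G k *m (0 : 'cV[R]_nd).
pose u := Ccs K k *m (0 : 'cV[R]_nx) + Ccp K k *m thc + Dc K k *m y.
pose phi := Aps G k *m (0 : 'cV[R]_nx) + App G k *m th
  + B1p G k *m (0 : 'cV[R]_nd) + B2p G k *m u.
pose phic := Acps K k *m (0 : 'cV[R]_nx) + Acpp K k *m thc + Bcp K k *m y.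
have phiE : loop_mx k *m col_mx th thc = col_mx phi phic.
  have -> := loop_eq (erefl y) (erefl u).
  by rewrite /loop_input !(mulmx0, addr0) col_mx0 addr0.
rewrite phiE mul_block_col !mul0mx addr0 add0r => /eq_col_mx[thE thcE].
apply/eqP; apply/negPn/negP => x0.
have x'0 : col_mx (col_mx (col_mx (0 : 'cV[R]_nx) th) (0 : 'cV[R]_nd))
    (col_mx (0 : 'cV[R]_nx) thc) != 0.
  apply: contraNneq x0 => /eqP; rewrite !col_mx_eq0 => /andP[].
  by case/andP => /andP[_ /eqP ->] _ /andP[_ /eqP ->]; rewrite !eqxx.
have := dissipation (erefl y) (erefl u) x'0; rewrite -/phi -/phic.
have := block_storage_contraction k phi phic ad; rewrite -thE -thcE.
set v' := V k.+1 _ _; set e := (C1s G k *m _ + _ + _ + _).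
have v'_ge0 : 0 <= v' by exact: block_storage_ge0.
have e_ge0 : 0 <= b^-1 * qform 1%:M e.
  by rewrite mulr_ge0 ?qform1_ge0 // invr_ge0 ltW.
rewrite qform0 mulr0 [V k 0 0]block_storage0; lra.
Qed.

Definition loop_sol k (z zc : 'cV[R]_nx) (d : 'cV[R]_nd) : 'cV[R]_(l + l) :=
  invmx (1%:M - De k *m loop_mx k) *m (De k *m loop_input k z zc d).

Definition loop_y k (z zc : 'cV[R]_nx) d : 'cV[R]_ny :=
  C2s G k *m z + C2p G k *m usubmx (loop_sol k z zc d) + D21 G k *m d.
Definition loop_u k (z zc : 'cV[R]_nx) d : 'cV[R]_nu :=
  Ccs K k *m zc + Ccp K k *m dsubmx (loop_sol k z zc d) + Dc K k *m loop_y k z zc d.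

Lemma loop_sol_uniq k (z zc : 'cV[R]_nx) (th thc : 'cV[R]_l) d y u :
  y = C2s G k *m z + C2p G k *m th + D21 G k *m d ->
  u = Ccs K k *m zc + Ccp K k *m thc + Dc K k *m y ->
  th = DeltaM m delta k *m
    (Aps G k *m z + App G k *m th + B1p G k *m d + B2p G k *m u) ->
  thc = DeltaM m delta k *m
    (Acps K k *m zc + Acpp K k *m thc + Bcp K k *m y) ->
  col_mx th thc = loop_sol k z zc d.
Proof.
move=> yE uE thE thcE; rewrite /loop_sol.
apply: (canRL (mulKmx (loop_unit k))); rewrite mulmxBl mul1mx -mulmxA.
apply/eqP; rewrite subr_eq addrC -mulmxDr -(loop_eq yE uE); apply/eqP.
by rewrite mul_block_col !mul0mx addr0 add0r -thE -thcE.
Qed.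

Lemma loop_solP k (z zc : 'cV[R]_nx) d :
  let th := usubmx (loop_sol k z zc d) in let thc := dsubmx (loop_sol k z zc d) in
  th = DeltaM m delta k *m
    (Aps G k *m z + App G k *m th + B1p G k *m d + B2p G k *m loop_u k z zc d) /\
  thc = DeltaM m delta k *m
    (Acps K k *m zc + Acpp K k *m thc + Bcp K k *m loop_y k z zc d).
Proof.
move=> th thc; apply: eq_col_mx.
have := loop_eq (erefl (loop_y k z zc d)) (erefl (loop_u k z zc d)).
rewrite -/th -/thc => E.
have -> a1 a2 : col_mx (DeltaM m delta k *m a1) (DeltaM m delta k *m a2)
    = De k *m col_mx a1 a2.
  by rewrite mul_block_col !mul0mx addr0 add0r.
rewrite [X in _ = _ *m X]E mulmxDr vsubmxK mulmxA; apply/eqP.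
rewrite addrC -subr_eq -[X in X - _]mul1mx -mulmxBl /loop_sol.
by rewrite mulKVmx ?loop_unit.
Qed.

Fixpoint loop_state (z0 : 'cV[R]_nx) (d : nat -> 'cV[R]_nd) k
    : 'cV[R]_nx * 'cV[R]_nx :=
  if k is k'.+1 then
    let z := (loop_state z0 d k').1 in let zc := (loop_state z0 d k').2 in
    let w := loop_sol k' z zc (d k') in
    (Ass G k' *m z + Asp G k' *m usubmx w + B1s G k' *m d k'
       + B2s G k' *m loop_u k' z zc (d k'),
     Acss K k' *m zc + Acsp K k' *m dsubmx w + Bcs K k' *m loop_y k' z zc (d k'))
  else (z0, 0).

Definition loop_signals z0 d : cl_signals nx m nd ne K :=
  let z k := (loop_state z0 d k).1 in let zc k := (loop_state z0 d k).2 in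
  let th k := usubmx (loop_sol k (z k) (zc k) (d k)) in
  let thc k := dsubmx (loop_sol k (z k) (zc k) (d k)) in
  let u k := loop_u k (z k) (zc k) (d k) in
  let y k := loop_y k (z k) (zc k) (d k) in
  @ClSignals R nx p m nd ne nu ny K z th
    (fun k => Aps G k *m z k + App G k *m th k + B1p G k *m d k + B2p G k *m u k)
    u
    (fun k => C1s G k *m z k + C1p G k *m th k + D11 G k *m d k + D12 G k *m u k)
    y zc thc
    (fun k => Acps K k *m zc k + Acpp K k *m thc k + Bcp K k *m y k).

Lemma loop_signals_traj z0 d : cl_traj G delta z0 d (loop_signals z0 d).
Proof.
split=> //; split=> // k.
have [thE thcE] := loop_solP k (loop_state z0 d k).1 (loop_state z0 d k).2 (d k).
by split; split.
Qed.

(** The algebraic loop has a single solution at each time, so the current states and disturbance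
    determine the other signals, and induction determines the states. *)
Lemma loop_signals_uniq z0 d s : cl_traj G delta z0 d s -> loop_signals z0 d = s.
Proof.
case: s => z th phi u e y zc thc phic [/= z_0 [zc_0 tr]].
have sol k : col_mx (th k) (thc k) = loop_sol k (z k) (zc k) (d k).
  have [[_ phiE _ yE thE] [_ phicE uE thcE]] := tr k.
  by apply: (loop_sol_uniq yE uE); rewrite -?phiE -?phicE.
have thE k : th k = usubmx (loop_sol k (z k) (zc k) (d k)).
  by rewrite -sol col_mxKu.
have thcE k : thc k = dsubmx (loop_sol k (z k) (zc k) (d k)).
  by rewrite -sol col_mxKd.
have yE k : y k = loop_y k (z k) (zc k) (d k).
  by have [[_ _ _ -> _] _] := tr k; rewrite thE.
have uE k : u k = loop_u k (z k) (zc k) (d k).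
  by have [_ [_ _ -> _]] := tr k; rewrite thcE yE.
have stE k : loop_state z0 d k = (z k, zc k).
  elim: k => [|k IHk] /=; first by rewrite z_0 zc_0.
  have [[-> _ _ _ _] [-> _ _ _]] := tr k.
  by rewrite IHk /= thE thcE uE yE.
rewrite /loop_signals; congr ClSignals;
  apply: functional_extensionality_dep => k; rewrite stE //=.
- by have [[_ -> _ _ _] _] := tr k; rewrite thE uE.
- by have [[_ _ -> _ _] _] := tr k; rewrite thE uE.
- by rewrite thcE.
- by have [_ [_ -> _ _]] := tr k; rewrite thcE yE.
Qed.

End Trajectories.

Lemma controller_wellposed : cl_wellposed G K.
Proof.
move=> delta ad z0 d; exists (loop_signals delta z0 d); split.
  exact: loop_signals_traj.
by move=> s; exact: loop_signals_uniq.
Qed.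

(** In the sum over time the state storages telescope, and the channel terms drop out because [Vb]
    at [(th, thc)] is at most [Vb] at [(phi, phic)]. *)
Lemma energy_bound delta z0 d (s : cl_signals nx m nd ne K) N :
  admissible delta -> cl_traj G delta z0 d s ->
  b^-1 * (\sum_(0 <= k < N) qform 1%:M (se s k)) <=
  V 0 z0 0 + f * (\sum_(0 <= k < N) qform 1%:M (d k)).
Proof.
move=> ad [s0 [c0 tr]].
(* The terminal storage is kept for the induction and dropped afterwards, being nonnegative. *)
suff : V N (sz s N) (szc s N) + b^-1 * (\sum_(0 <= k < N) qform 1%:M (se s k)) <=
    V 0 z0 0 + f * (\sum_(0 <= k < N) qform 1%:M (d k)).
  by apply: le_trans; rewrite lerDr; exact: block_storage_ge0.
elim: N => [|N IHN]; first by rewrite !big_nil !mulr0 !addr0 s0 c0.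
rewrite !big_nat_recr //=.
have [[zE phiE eE yE thE] [zcE phicE uE thcE]] := tr N.
have := dissipation_le yE uE; rewrite -zE -zcE -phiE -phicE -eE.
have := block_storage_contraction N (sphi s N) (sphic s N) ad.
rewrite -thE -thcE; lra.
Qed.

End ClosedLoop.

(** * Energy of signals *)

Section SignalNorm.
Variable R : realType.

Lemma l2sq_ge n (x : nat -> 'cV[R]_n) N :
  ((\sum_(0 <= k < N) qform 1%:M (x k))%:E <= l2sq x)%E.
Proof.
rewrite -sumEFin /l2sq; under eq_bigr do rewrite qform1.
apply: nneseries_lim_ge => k _ _; rewrite lee_fin.
by apply: sumr_ge0 => j _; exact: sqr_ge0.
Qed.

Lemma l2sq_le n (x : nat -> 'cV[R]_n) c :
  (forall N, \sum_(0 <= k < N) qform 1%:M (x k) <= c) -> (l2sq x <= c%:E)%E.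
Proof.
move=> xc; apply: lime_le.
  apply: is_cvg_nneseries => k _ _; rewrite lee_fin.
  by apply: sumr_ge0 => j _; exact: sqr_ge0.
apply: nearW => N; under eq_bigr do rewrite -qform1.
by rewrite sumEFin lee_fin.
Qed.

Lemma l2sq_le1 n (x : nat -> 'cV[R]_n) : (l2norm x <= 1)%E -> (l2sq x <= 1)%E.
Proof.
have := l2sq_ge x 0; rewrite big_nil /l2norm.
case: (l2sq x) => [r| |] //; rewrite !lee_fin => r0 r1.
by rewrite -(sqr_sqrtr r0) expr_le1 ?sqrtr_ge0.
Qed.

Lemma l2norm_le n (x : nat -> 'cV[R]_n) c :
  (l2sq x <= c%:E)%E -> (l2norm x <= (Num.sqrt c)%:E)%E.
Proof.
rewrite /l2norm; case: (l2sq x) => [r| |] /=.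
- by rewrite !lee_fin; exact: ler_wsqrtr.
- by rewrite leye_eq.
- by rewrite !leNye.
Qed.

End SignalNorm.

(** * Periodic extension *)

Section PeriodicIndex.
Variables hb q : nat.
Hypothesis q_gt0 : (0 < q)%N.

(** Representative of time [k] in the window below [hb + q]; data known on the window and read at
    this index become eventually periodic. *)
Definition fold_index k := if (k < hb)%N then k else (hb + (k - hb) %% q)%N.

Lemma fold_index_lt k : (fold_index k < hb + q)%N.
Proof.
rewrite /fold_index; case: (ltnP k hb) => [khb|_]; first by rewrite ltn_addr.
by rewrite ltn_add2l ltn_pmod.
Qed.

Lemma fold_index_period k i : fold_index (hb + k + i * q) = fold_index (hb + k).
Proof.
rewrite /fold_index -addnA !ltnNge !leq_addr /= !addKn.
by rewrite (addnC k) modnMDl.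
Qed.

Lemma fold_index0 : fold_index 0 = 0%N.
Proof. by rewrite /fold_index sub0n mod0n addn0; case: posnP. Qed.

(** The successor leaves the window only from [hb + q - 1]; there [perext] reads [F hb], which is
    where folding restarts. *)
Lemma perext_fold T (F : nat -> T) k :
  perext hb q F (fold_index k).+1 = F (fold_index k.+1).
Proof.
rewrite /perext /fold_index; case: (ltnP k hb) => khb.
  rewrite ifN; last by lia.
  case: ltnP => // hbk; have -> : k.+1 = hb by lia.
  by rewrite subnn mod0n addn0.
rewrite ltnNge (leqW khb) /= subSn // -addnS eqn_add2l -(addn1 (k - hb)%N) -modnDml addn1.
case: eqVneq => [->|rq]; first by rewrite modnn addn0.
by rewrite [(_.+1 %% q)%N]modn_small // ltn_neqAle rq ltn_pmod.
Qed.

Lemma ev_periodic_fold (R : realType) r c (P : nat -> 'M[R]_(r, c)) h k :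
  ev_periodic P h q -> (h <= hb)%N -> P (fold_index k) = P k.
Proof.
move=> Pp hhb; rewrite /fold_index; case: (ltnP k hb) => // hbk.
have := Pp ((k - hb) %/ q)%N (hb - h + (k - hb) %% q)%N.
have -> : (h + (hb - h + (k - hb) %% q) = hb + (k - hb) %% q)%N by lia.
by move=> <-; congr P; have := divn_eq (k - hb) q; lia.
Qed.

End PeriodicIndex.

(** * Scaled certificates and the performance bound *)

Lemma mxdiag_scale (R : realType) p (m : 'I_p -> nat) (c : R)
    (B : forall i, 'M[R]_(m i)) :
  \mxdiag_i (c *: B i) = c *: \mxdiag_i B i.
Proof.
rewrite -mul_scalar_mx -mxdiagZ [X in _ = _ *m X]/mxdiag mul_mxdiag_mxblock.
apply: eq_mxblock => i j; case: eqVneq => [<-|_]; last by rewrite mulmx0.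
by rewrite !conform_mx_id mul_scalar_mx.
Qed.

Lemma diag3_scale (R : realType) n1 n2 n3 (c r : R) (A : 'M[R]_n1) (B : 'M[R]_n2) :
  diag3 (c *: A) (c *: B) ((c * r)%:M : 'M[R]_n3) = c *: diag3 A B r%:M.
Proof. by rewrite /diag3 !scale_block_mx !scaler0 scale_scalar_mx. Qed.

Unset Implicit Arguments.

Theorem theorem3 (R : realType)
  (nx p : nat) (m : 'I_p -> nat) (nd ne nu ny : nat)
  (G : plant R nx m nd ne nu ny)
  (h q : nat) (q_gt0 : (0 < q)%N) (HG : plant_ev_periodic G h q)
  (a : nat) (sd : 'I_a -> nat) (Hs : (\sum_(i < a) sd i <= nx)%N)
  (Gamma : 'M[R]_(nx, \sum_(i < a) sd i))
  (gamma : R) (hb : nat) (Hhb : (h <= hb)%N)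
  (rR rS : nat -> nat)
  (NR : forall k : nat, 'M[R]_(nx + \sum_(i < p) m i + ne, rR k))
  (NS : forall k : nat, 'M[R]_(nx + \sum_(i < p) m i + nd, rS k))
  (HNR : forall k : nat, (k < hb + q)%N ->
     im_eq_ker (NR k) (row3 (B2s G k)^T (B2p G k)^T (D12 G k)^T)
     /\ (NR k)^T *m NR k = 1%:M)
  (HNS : forall k : nat, (k < hb + q)%N ->
     im_eq_ker (NS k) (row3 (C2s G k) (C2p G k) (D21 G k))
     /\ (NS k)^T *m NS k = 1%:M) :
  (exists (R0 S0 : nat -> 'M[R]_nx)
          (Rb Sb : nat -> forall i : 'I_p, 'M[R]_(m i))
          (b : R) (f1 : 'I_a -> R) (f2 g t : R),
     [/\ (forall k : nat, (k < hb + q)%N ->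
            [/\ posdef (R0 k), posdef (S0 k),
                forall i : 'I_p, posdef (Rb k i) /\ posdef (Sb k i) &
                possemidef (block_mx (R0 k) 1%:M 1%:M (S0 k))
                /\ forall i : 'I_p,
                     possemidef (block_mx (Rb k i) 1%:M 1%:M (Sb k i))]),
         [/\ 0 < b, forall i : 'I_a, 0 < f1 i, 0 < f2, 0 < g & 0 < t],
         b + \sum_(i < a) f1 i + f2 < 2 * gamma
         /\ posdef ((\mxdiag_(i < a) ((f1 i)%:M : 'M[R]_(sd i)))
                     - Gamma^T *m S0 0%N *m Gamma),
         (forall k : nat, (k < hb + q)%N ->
            let H := mx3 (Ass G k) (Asp G k) (B1s G k)
                         (Aps G k) (App G k) (B1p G k)
                         (C1s G k) (C1p G k) (D11 G k) in
            let Rbar := \mxdiag_(i < p) Rb k i in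
            let Sbar := \mxdiag_(i < p) Sb k i in
            negdef ((NR k)^T *m
              (H *m diag3 (R0 k) Rbar (g%:M : 'M[R]_nd) *m H^T
               - diag3 (perext hb q R0 k.+1) Rbar (b%:M : 'M[R]_ne)) *m NR k)
            /\
            negdef ((NS k)^T *m
              (H^T *m diag3 (perext hb q S0 k.+1) Sbar (t%:M : 'M[R]_ne) *m H
               - diag3 (S0 k) Sbar (f2%:M : 'M[R]_nd)) *m NS k)) &
         possemidef (block_mx (g%:M : 'M[R]_1) 1 1 (f2%:M : 'M[R]_1))
         /\ possemidef (block_mx (t%:M : 'M[R]_1) 1 1 (b%:M : 'M[R]_1))]) ->
  exists K : controller R p nu ny,
    [/\ ctrl_ev_periodic K hb q, cl_wellposed G K &
        (cl_worst_gain G K Gamma < gamma%:E)%E].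
Proof.
case=> R0 [S0 [Rb [Sb [b [f1 [f2 [g [t]]]]]]]].
case=> Hpos [b_gt0 f1_gt0 f2_gt0 g_gt0 t_gt0] [Hgamma HGamma] Hlmi [Hg Ht].
pose F := \sum_(i < a) f1 i + f2.
have F_gt0 : 0 < F.
  by rewrite ltr_wpDl // sumr_ge0 // => i _; exact/ltW.
(* The conditions on [S], [t], [f1], [f2] are homogeneous: scaling by [c > 1]
   preserves them and makes the coupling of [R] and [S] strict. *)
have [c c_gt1 cF] : exists2 c, 1 < c & b + c * F < 2 * gamma.
  (* This [c] uses half of the slack [2 * gamma - b - F]. *)
  exists (1 + (2 * gamma - b - F) / (2 * F)).
    by rewrite ltrDl divr_gt0 ?mulr_gt0 // -addrA -opprD subr_gt0 addrC /F; lra.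
  have -> : (1 + (2 * gamma - b - F) / (2 * F)) * F = F + (2 * gamma - b - F) / 2.
    by field; rewrite gt_eqF.
  by rewrite /F in F_gt0 *; lra.
have c_gt0 : 0 < c by apply: lt_trans c_gt1.
pose idx := fold_index hb q.
(* At zero controller state, the storages built from these weights are the forms of [c *: S0] and
   [c *: Sb]. *)
pose Y0 j := invmx (R0 j); pose P0 j := c *: S0 j - invmx (R0 j).
pose Yb j i := invmx (Rb j i); pose Pb j i := c *: Sb j i - invmx (Rb j i).
(* [perext] at [j.+1] reads an index inside the window: [hb] if [j.+1 = hb + q], where [0 < q]
   matters, and [j.+1] otherwise. *)
have posx j (Q : 'M[R]_nx -> Prop) (A : nat -> 'M[R]_nx) :
    (forall k, (k < hb + q)%N -> Q (A k)) -> (j < hb + q)%N -> Q (perext hb q A j.+1).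
  move=> QA jhb; rewrite /perext; case: eqVneq => [_|neq]; apply: QA.
    by rewrite -[ltnLHS]addn0 ltn_add2l.
  by rewrite ltn_neqAle neq.
have Y0p j : (j < hb + q)%N -> posdef (Y0 j).
  by move=> /Hpos[Rp _ _ _]; exact: posdef_invmx.
have P0p j : (j < hb + q)%N -> posdef (P0 j).
  by move=> /Hpos[Rp Sp _ [RS _]]; exact: posdef_coupling.
have Ybp j i : (j < hb + q)%N -> posdef (Yb j i).
  by move=> /Hpos[_ _ /(_ i)[Rp _] _]; exact: posdef_invmx.
have Pbp j i : (j < hb + q)%N -> posdef (Pb j i).
  by move=> /Hpos[_ _ /(_ i)[Rp Sp] [_ RS]]; exact: posdef_coupling.
(* The bound on [j] stands under the existential so that [choice] yields a total function; outside
   the window 0 is a placeholder. *)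
have step j : exists Th :
    'M[R]_(nu + (nx + \sum_(i < p) m i), ny + (nx + \sum_(i < p) m i)),
    (j < hb + q)%N -> forall x xc w,
    w = Th *m col_mx (plant_C G j *m x) xc -> col_mx x xc != 0 ->
    storage (diag3 (perext hb q Y0 j.+1) (\mxdiag_i Yb j i) (b^-1)%:M)
      (block_mx (perext hb q P0 j.+1) 0 0 (\mxdiag_i Pb j i))
      (plant_H G j *m x + plant_B G j *m usubmx w) (dsubmx w) <
    storage (diag3 (Y0 j) (\mxdiag_i Yb j i) (c * f2)%:M)
      (block_mx (P0 j) 0 0 (\mxdiag_i Pb j i)) x xc.
  case: (ltnP j (hb + q)) => [jhb|_]; last by exists 0.
  have [LR LS] := Hlmi j jhb; have [kerR _] := HNR j jhb; have [kerS _] := HNS j jhb.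
  have Y0E : perext hb q Y0 j.+1 = invmx (perext hb q R0 j.+1).
    by rewrite /perext /Y0; case: ifP.
  have P0E : perext hb q P0 j.+1 = c *: perext hb q S0 j.+1 - invmx (perext hb q R0 j.+1).
    by rewrite /perext /P0; case: ifP.
  have PbE : \mxdiag_i Pb j i = c *: \mxdiag_i Sb j i - \mxdiag_i Yb j i.
    by rewrite -mxdiag_scale -mxdiagB.
  have Sc n l k (A : 'M[R]_n) (B : 'M[R]_l) (r : R) (x : 'cV[R]_(n + l + k)) :
      qform (diag3 (c *: A) (c *: B) (c * r)%:M) x = c * qform (diag3 A B r%:M) x.
    by rewrite diag3_scale /qform bilin_scale.
  have [|||||||||||||Th HTh] := @step_synthesis R nx (\sum_(i < p) m i) nd ne nu ny
    (plant_H G j) (plant_B G j) (plant_C G j) (R0 j) (c *: S0 j)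
    (perext hb q R0 j.+1) (c *: perext hb q S0 j.+1) (\mxdiag_i Rb j i)
    (c *: \mxdiag_i Sb j i) (\mxdiag_i Yb j i) b (c * f2) g (c * t).
  - by have [] := Hpos j jhb.
  - by apply: posx jhb => k /Hpos[].
  - by apply: posdef_mxdiag => i; exact: Ybp.
  - by apply: mxdiag_invK => i; have [_ _ /(_ i)[]] := Hpos j jhb.
  - exact: P0p.
  - by rewrite -P0E; apply: posx jhb => k; exact: P0p.
  - by rewrite -PbE; apply: posdef_mxdiag => i; exact: Pbp.
  - by [].
  - exact: mulr_gt0.
  (* Scaling only relaxes the scalar couplings: [g^-1 <= f2 <= c * f2] and, below,
     [b^-1 <= t <= c * t]. *)
  - have gf := coupling_scalar g_gt0 Hg.
    rewrite -[g]invrK lef_pV2 ?posrE ?mulr_gt0 ?invr_gt0 //.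
    by apply: le_trans gf _; rewrite ler_peMl ?ltW.
  - have tb := coupling_scalar t_gt0 Ht.
    have : b^-1 <= t by rewrite -[t]invrK lef_pV2 ?posrE ?invr_gt0.
    by move=> bt; apply: le_trans bt _; rewrite ler_peMl ?ltW.
  - move=> x x0 Cx; rewrite !Sc ltr_pM2l //.
    rewrite qform_mul; exact: (negdef_on_ker kerS LS).
  - move=> w w0 Bw; rewrite qform_mul trmxK; apply: (negdef_on_ker kerR LR) => //.
    by rewrite -[RHS]Bw /plant_B !tr_col_mx.
  exists Th => _ x xc w wE x0; rewrite Y0E P0E PbE; exact: HTh.
have [Th HTh] := choice step.
pose Thf k := Th (idx k); exists (controller_of Thf).
have idx_lt k : (idx k < hb + q)%N by exact: fold_index_lt.
have GE k r l (P : nat -> 'M[R]_(r, l)) : ev_periodic P h q -> P (idx k) = P k.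
  by move=> Pp; exact: ev_periodic_fold Pp Hhb.
have [HAss [HAsp [HB1s [HB2s [HAps [HApp [HB1p [HB2p [HC1s [HC1p [HD11 [HD12
  [HC2s [HC2p HD21]]]]]]]]]]]]]] := HG.
have HE k : plant_H G (idx k) = plant_H G k by rewrite /plant_H !GE.
have BE k : plant_B G (idx k) = plant_B G k by rewrite /plant_B !GE.
have CE k : plant_C G (idx k) = plant_C G k by rewrite /plant_C !GE.
have ThP k x xc w :
    w = Thf k *m col_mx (plant_C G k *m x) xc -> col_mx x xc != 0 ->
    storage (diag3 (Y0 (idx k.+1)) (\mxdiag_i Yb (idx k) i) (b^-1)%:M)
      (block_mx (P0 (idx k.+1)) 0 0 (\mxdiag_i Pb (idx k) i))
      (plant_H G k *m x + plant_B G k *m usubmx w) (dsubmx w) <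
    storage (diag3 (Y0 (idx k)) (\mxdiag_i Yb (idx k) i) (c * f2)%:M)
      (block_mx (P0 (idx k)) 0 0 (\mxdiag_i Pb (idx k) i)) x xc.
  (* The window inequality at [idx k] becomes the one at time [k]: the plant is periodic and
     [perext] turns [(idx k).+1] into [idx k.+1]. *)
  have := HTh (idx k) (idx_lt k) x xc w; rewrite /idx !(perext_fold _ q_gt0) -/idx.
  by rewrite HE BE CE.
have cf2 : 0 < c * f2 by exact: mulr_gt0.
have pY0 k : posdef (Y0 (idx k)) by exact: Y0p.
have pP0 k : posdef (P0 (idx k)) by exact: P0p.
have pYb k i : posdef (Yb (idx k) i) by exact: Ybp.
have pPb k i : posdef (Pb (idx k) i) by exact: Pbp.
split.
(* As the controller dimensions are constant, equality of the dependent pairs reduces to periodicity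
   of [Thf]. *)
- have per i k : Thf (hb + k + i * q)%N = Thf (hb + k)%N.
    by rewrite /Thf /idx fold_index_period.
  by do ![split]; move=> i k /=; rewrite per.
- exact: (controller_wellposed pY0 pP0 pYb pPb b_gt0 ThP).
(* A uniform bound strictly below [gamma] keeps the supremum strict; [b * (c * F)] and [gamma] are
   compared by the arithmetic-geometric mean inequality. *)
apply: (@le_lt_trans _ _ (Num.sqrt (b * (c * F)))%:E); last first.
  rewrite lte_fin; apply: (@le_lt_trans _ _ ((b + c * F) / 2)); last by lra.
  have cF0 : 0 < c * F by exact: mulr_gt0.
  have mean0 : 0 <= (b + c * F) / 2 by lra.
  rewrite -(ger0_norm mean0) -sqrtr_sqr ler_wsqrtr // -subr_ge0.
  have -> : ((b + c * F) / 2) ^+ 2 - b * (c * F) = ((b - c * F) / 2) ^+ 2 by field.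
  exact: sqr_ge0.
apply: ge_ereal_sup => _ [s [xi [d [delta [xi1 d1 ad tr]]]] <-].
apply: l2norm_le; apply: l2sq_le => N.
have := energy_bound pY0 pP0 pYb pPb ThP N ad tr.
have dN : \sum_(0 <= k < N) qform 1%:M (d k) <= 1.
  by rewrite -lee_fin; apply: le_trans (l2sq_ge d N) (l2sq_le1 d1).
(* The condition on [Gamma] bounds this form by the sum of [f1 i] times the squared norm of [xi i],
   which is at most 1. *)
have z0S : qform (S0 0%N) (Gamma *m \mxcol_(i < a) xi i) <= \sum_(i < a) f1 i.
  rewrite qform_mul; apply: (@le_trans _ _
    (qform (\mxdiag_(i < a) ((f1 i)%:M : 'M[R]_(sd i))) (\mxcol_(i < a) xi i))).
    rewrite -subr_ge0 /qform -bilin_oppmx -bilin_addmx.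
    exact: (posdef_ge0 _ HGamma).
  rewrite qform_mxdiag; apply: ler_sum => i _; rewrite mxcolK qform_scalar.
  have := xi1 i; rewrite /vnorm -qform1 => xi_le1.
  apply: ler_piMr; first exact/ltW.
  by rewrite -(sqr_sqrtr (qform1_ge0 (xi i))) expr_le1 ?sqrtr_ge0.
have -> z0 : block_storage (Y0 (idx 0%N)) (P0 (idx 0%N)) z0 0 = c * qform (S0 0%N) z0.
  rewrite /idx fold_index0 /block_storage subr0 /P0 /Y0 /qform bilin_addmx.
  by rewrite bilin_oppmx bilin_scale addrC subrK.
(* The energy of [e] is at most [b] times [c * \sum f1 i + c * f2 = c * F]. *)
rewrite ler_pdivrMl // => /le_trans; apply; rewrite ler_pM2l //.
rewrite /F mulrDr lerD // ?ler_pM2l //.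
by rewrite -[leRHS]mulr1 ler_pM2l.
Qed.
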